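(* Let $p\ge4$ be an even integer. If $G$ is a nonempty graph on $v$ vertices with $e$ edges containing no circuit of length $p$, then $$e\le 18\pi^2p^2\,v^{1+2/p}.$$ If moreover $G$ is bipartite with vertex classes of sizes $m$ and $n$, then $$e\le 9\pi^2p^2\min(m,n)^{2/p}\max(m,n).$$
   Context: Graphs are finite simple graphs. A circuit of length $p$ in a graph is a sequence $(v_1,\dots,v_p)$ of vertices such that $\{v_1,v_2\},\dots,\{v_{p-1},v_p\},\{v_p,v_1\}$ are pairwise distinct edges of the graph (the vertices need not be pairwise distinct). *)

(* Defs.v *)
From HB Require Import structures.
From mathcomp Require Import all_boot all_order all_algebra.
From mathcomp Require Import all_classical all_reals all_analysis.
Set Implicit Arguments. Unset Strict Implicit. Unset Printing Implicit Defensive.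
Import Order.TTheory GRing.Theory Num.Theory.

(* A finite simple graph is a symmetric irreflexive relation g on a finType T. *)

Definition edges (T : finType) (g : rel T) : {set {set T}} :=
  [set E : {set T} | [exists x, exists y, g x y && (E == [set x; y])]].

Definition nedges (T : finType) (g : rel T) : nat := #|edges g|.

Definition has_circuit (T : finType) (g : rel T) (p : nat) : Prop :=
  exists c : 'I_p -> T,
    (forall i : 'I_p, g (c i) (c (ordS i))) /\
    injective (fun i : 'I_p => [set c i; c (ordS i)]).

(* Main.v *)
(* Put on each edge [xy] the weight [1 / sqrt (max (d x) (d y))], [d] being the
   degree, and let [M] be the weighted adjacency matrix; the squares in a row of
   [M] sum to at most 1.  Write [p = 2 K].  Without circuits of length [p], every
   closed walk of length [p] uses some edge at two steps [i < j].  By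
   Cauchy-Schwarz and log-convexity of [j |-> (M^(2j))_xx], the closed walks for
   fixed [i, j] have total weight at most [4 tr M^(p-2)], so
   [tr M^p <= 4 'C(p, 2) tr M^(p-2)].  Log-convexity again turns this into
   [tr M^p <= |T| (4 p^2)^K].  On the other hand [tr M^p >= (|M 1|^2 / |T|)^K],
   and the choice of weights makes [|M 1|^2] at least half the number of edges,
   however irregular the graph is.  In the bipartite case both classes contribute
   equally to the trace, so [|T|] may be replaced by twice the smaller class in
   the upper bound. *)
Require Import Defs.
From HB Require Import structures.
From mathcomp Require Import all_boot all_order all_algebra.
From mathcomp Require Import all_classical all_reals all_analysis.
From mathcomp Require Import zify ring lra.
Set Implicit Arguments. Unset Strict Implicit. Unset Printing Implicit Defensive.
Import Order.TTheory GRing.Theory Num.Theory.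
Local Open Scope ring_scope.

(** * Log-convex sequences with nonnegative terms *)

Section LogConvex.
Variables (R : realFieldType) (s : nat -> R).
Hypothesis s_ge0 : forall n, 0 <= s n.
Hypothesis s_logconvex : forall n, s n.+1 ^+ 2 <= s n * s n.+2.

(** Consecutive ratios increase. Cross-multiplication allows vanishing terms: a zero term forces the
    next one to be zero. *)
Lemma logconvex_ratio i j : (i <= j)%N -> s i.+1 * s j <= s i * s j.+1.
Proof.
move=> /subnKC <-; elim: (j - i)%N => [|d IHd]; first by rewrite addn0 mulrC.
rewrite addnS.
have := s_ge0 (i + d)%N; rewrite le_eqVlt => /predU1P[z0|spos].
  have := s_logconvex (i + d)%N; rewrite -z0 mul0r => sq_le0.
  have /eqP -> : s (i + d).+1%N == 0 by rewrite -sqrf_eq0 eq_le sq_le0 sqr_ge0.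
  by rewrite mulr0 mulr_ge0.
rewrite -(ler_pM2r spos) mulrAC (le_trans (ler_wpM2r (s_ge0 _) IHd)) //.
by rewrite -!mulrA -expr2 ler_wpM2l // mulrC s_logconvex.
Qed.

(** The ratio at [n] dominates all earlier ones, so a bound [l] on it lets [s n] telescope down to
    [s 0]. *)
Lemma logconvex_le_geom l n :
  0 <= l -> s n.+1 <= l * s n -> s n <= l ^+ n * s 0.
Proof.
move=> l_ge0 s_le.
have := s_ge0 n; rewrite le_eqVlt => /predU1P[<-|sn_gt0].
  by rewrite mulr_ge0 ?exprn_ge0.
have step i : (i <= n)%N -> s i.+1 <= l * s i.
  move=> /logconvex_ratio ratio; rewrite -(ler_pM2r sn_gt0).
  by rewrite (le_trans ratio) // mulrAC mulrC ler_wpM2r.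
suff: forall i, (i <= n)%N -> s i <= l ^+ i * s 0 by apply.
elim=> [|i IHi] lt_in; first by rewrite mul1r.
rewrite (le_trans (step i (ltnW lt_in))) // exprS -mulrA ler_wpM2l //.
exact/IHi/ltnW.
Qed.

(** A convex function lies below its chord. Going down from [n.+1] to [n], a failure [r ^+ n < s n]
    would make the ratio at [n] at most [r], hence [s n] at most [r ^+ n * s 0]. *)
Lemma logconvex_le_root r n j :
  0 <= r -> s 0 <= 1 -> s n <= r ^+ n -> (j <= n)%N -> s j <= r ^+ j.
Proof.
move=> r_ge0 s0_le1; elim: n => [|n IHn] sn_le.
  by rewrite leqn0 => /eqP ->.
rewrite leq_eqVlt => /predU1P[-> //|]; rewrite ltnS; apply: IHn.
rewrite leNgt; apply/negP => lt_sn.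
have: s n <= r ^+ n * s 0.
  apply: logconvex_le_geom => //; rewrite (le_trans sn_le) // exprS.
  by rewrite ler_wpM2l // ltW.
by rewrite leNgt (le_lt_trans _ lt_sn) // ler_piMr // exprn_ge0.
Qed.

(** Either the ratio at [n] is at most [l] and the geometric bound applies, or [s n] is below
    [s n.+1 / l]. Adding the two bounds gives one inequality that can be summed over vertices. *)
Lemma logconvex_le_threshold l n :
  0 < l -> s n <= l ^+ n * s 0 + s n.+1 / l.
Proof.
move=> l_gt0; have [le_s|/ltW ge_s] := leP (s n.+1) (l * s n).
  rewrite -[leLHS]addr0 lerD ?divr_ge0 ?(ltW l_gt0) //.
  by rewrite logconvex_le_geom ?(ltW l_gt0).
rewrite -[leLHS]add0r lerD ?mulr_ge0 ?exprn_ge0 ?(ltW l_gt0) //.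
by rewrite ler_pdivlMr // mulrC.
Qed.

Lemma logconvex_expr n : s 1 ^+ n * s 0 <= s 0 ^+ n * s n.
Proof.
elim: n => [|n IHn]; first by rewrite !mul1r.
rewrite exprS -mulrA (le_trans (ler_wpM2l (s_ge0 1) IHn)) //.
rewrite mulrCA exprSr -mulrA ler_wpM2l ?exprn_ge0 //.
exact: logconvex_ratio.
Qed.

End LogConvex.

(** * Finite sums and roots *)

Lemma cauchy_schwarz_sum (R : realFieldType) (I : finType) (u v : I -> R) :
  (\sum_i u i * v i) ^+ 2 <= (\sum_i u i ^+ 2) * (\sum_i v i ^+ 2).
Proof.
suff: 0 <= ((\sum_i u i ^+ 2) * (\sum_i v i ^+ 2) - (\sum_i u i * v i) ^+ 2) *+ 2.
  by rewrite -mulr_natl pmulr_rge0 ?ltr0n // subr_ge0.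
(* Lagrange's identity. *)
have ->: ((\sum_i u i ^+ 2) * (\sum_i v i ^+ 2) - (\sum_i u i * v i) ^+ 2) *+ 2
    = \sum_i \sum_j (u i * v j - u j * v i) ^+ 2.
  under [RHS]eq_bigr => i _.
    under eq_bigr => j _.
      have -> : (u i * v j - u j * v i) ^+ 2 =
        u i ^+ 2 * v j ^+ 2 + v i ^+ 2 * u j ^+ 2
        - 2 * (u i * v i) * (u j * v j) by ring.
      over.
    rewrite sumrB big_split /= -!mulr_sumr.
    over.
  rewrite sumrB big_split /= -!mulr_suml -mulr_sumr; ring.
by apply: sumr_ge0 => i _; apply: sumr_ge0 => j _; exact: sqr_ge0.
Qed.

Lemma ler_sum_term (R : numDomainType) (I : finType) (F : I -> R) (i : I) :
  (forall j, 0 <= F j) -> F i <= \sum_j F j.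
Proof. by move=> F_ge0; rewrite (bigD1 i) //= lerDl sumr_ge0. Qed.

Lemma exists_nth_root (R : realType) (n : nat) (a : R) :
  (0 < n)%N -> 0 <= a -> exists2 r : R, 0 <= r & r ^+ n = a.
Proof.
move=> n_gt0 a_ge0; exists (a `^ n%:R^-1); first exact: powR_ge0.
by rewrite -powR_mulrn ?powR_ge0 // -powRrM mulVf ?powRr1 // pnatr_eq0 -lt0n.
Qed.

(** * Entries of powers of a symmetric kernel *)

Section Kernel.
Variables (R : realType) (T : finType).
Implicit Types (B : T -> T -> R) (u v : T -> R) (x y : T).

Definition dot u v := \sum_x u x * v x.
Definition delta y : T -> R := fun x => (x == y)%:R.
Definition act B u : T -> R := fun x => \sum_y B x y * u y.

Lemma dot_delta x u : dot (delta x) u = u x.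
Proof.
rewrite /dot (bigD1 x) //= /delta eqxx mul1r big1 ?addr0 // => y /negPf->.
by rewrite mul0r.
Qed.

Lemma dotC u v : dot u v = dot v u.
Proof. by apply: eq_bigr => x _; rewrite mulrC. Qed.

Lemma dot_ge0 u : 0 <= dot u u.
Proof. by apply: sumr_ge0 => x _; rewrite -expr2 sqr_ge0. Qed.

Lemma dot_cauchy_schwarz u v : dot u v ^+ 2 <= dot u u * dot v v.
Proof.
have sq w : dot w w = \sum_x w x ^+ 2 by apply: eq_bigr => x _; rewrite expr2.
by rewrite !sq; exact: cauchy_schwarz_sum.
Qed.

Lemma act_scale B c u : act B (fun x => c * u x) = (fun x => c * act B u x).
Proof.
by apply/funext => x; rewrite mulr_sumr; apply: eq_bigr => y _; rewrite mulrCA.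
Qed.

Lemma iter_act_scale B n c u :
  iter n (act B) (fun x => c * u x) = (fun x => c * iter n (act B) u x).
Proof. by elim: n => //= n ->; rewrite act_scale. Qed.

Variable M : T -> T -> R.
Hypothesis M_sym : forall x y, M x y = M y x.

Lemma dot_act u v : dot (act M u) v = dot u (act M v).
Proof.
rewrite /dot; under eq_bigr do rewrite mulr_suml.
rewrite exchange_big; apply: eq_bigr => x _; rewrite mulr_sumr.
by apply: eq_bigr => y _; rewrite M_sym mulrCA mulrA.
Qed.

Lemma dot_iter a b u v :
  dot (iter a (act M) u) (iter b (act M) v) = dot u (iter (a + b) (act M) v).
Proof. by elim: a b => [|a IHa] b //; rewrite iterS dot_act -iterS IHa addnS. Qed.

(** The entry [(x, y)] of the [n]-th matrix power of [M]: the total weight of the walks of length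
    [n] from [x] to [y]. *)
Definition walks n x y := iter n (act M) (delta y) x.

Lemma walks_dot a b x y :
  dot (iter a (act M) (delta x)) (iter b (act M) (delta y)) = walks (a + b) x y.
Proof. by rewrite dot_iter dot_delta. Qed.

Lemma walksC n x y : walks n x y = walks n y x.
Proof. by rewrite -[n in LHS]addn0 -walks_dot dotC walks_dot. Qed.

Lemma walksD a b x y : \sum_z walks a x z * walks b z y = walks (a + b) x y.
Proof. by rewrite -walks_dot; apply: eq_bigr => z _; rewrite walksC. Qed.

Lemma walks_sq_le a b x y :
  walks (a + b) x y ^+ 2 <= walks (a + a) x x * walks (b + b) y y.
Proof. by rewrite -!walks_dot; exact: dot_cauchy_schwarz. Qed.

Lemma walks_diag_ge0 n x : 0 <= walks (n + n) x x.
Proof. by rewrite -walks_dot dot_ge0. Qed.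

(** Even powers give squared norms, nonnegative even for signed [M]; the claim is Cauchy-Schwarz for
    [M^n u] and [M^(n+2) u]. *)
Lemma dot_iter_logconvex u n :
  dot u (iter (n.+1 + n.+1) (act M) u) ^+ 2
  <= dot u (iter (n + n) (act M) u) * dot u (iter (n.+2 + n.+2) (act M) u).
Proof.
have -> : (n.+1 + n.+1 = n + n.+2)%N by rewrite addSnnS.
by rewrite -!dot_iter; exact: dot_cauchy_schwarz.
Qed.

Lemma walks_logconvex x n :
  walks (n.+1 + n.+1) x x ^+ 2 <= walks (n + n) x x * walks (n.+2 + n.+2) x x.
Proof. by rewrite /walks -!dot_delta dot_iter_logconvex. Qed.

Lemma walks0 x : walks (0 + 0) x x = 1.
Proof. by rewrite /walks /= /delta eqxx. Qed.

(** Log-convexity carries the bound from length [k + k] down to shorter even diagonal entries;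
    Cauchy-Schwarz then reaches off-diagonal entries and odd lengths. *)
Lemma walks_le_pow k r x y n :
  0 <= r -> walks (k + k) x x <= r ^+ (k + k) ->
  walks (k + k) y y <= r ^+ (k + k) -> (n <= k + k)%N -> walks n x y <= r ^+ n.
Proof.
move=> r_ge0 le_x le_y le_n.
have diag z m : walks (k + k) z z <= r ^+ (k + k) -> (m <= k)%N ->
    walks (m + m) z z <= r ^+ (m + m).
  have sqE i : r ^+ (i + i) = (r ^+ 2) ^+ i by rewrite -exprM mul2n addnn.
  rewrite (sqE k) (sqE m) => le_z le_m.
  apply: (@logconvex_le_root _ (fun i => walks (i + i) z z) _ _ _ k) => //.
  - by move=> i; exact: walks_diag_ge0.
  - by move=> i; exact: walks_logconvex.
  - exact: sqr_ge0.
  - by rewrite walks0.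
(* Both parts must stay at most [k], because the diagonal bounds stop at length [k + k]. *)
have [a a_le [b b_le ->]] : exists2 a, (a <= k)%N & exists2 b, (b <= k)%N & n = (a + b)%N.
  exists (minn n k); first by rewrite geq_minr.
  by exists (n - minn n k)%N; clear -le_n; lia.
have sq_le := walks_sq_le a b x y; have [|w_ge0] := ltP (walks (a + b) x y) 0.
  by move=> /ltW/le_trans; apply; rewrite exprn_ge0.
rewrite -(@ler_pXn2r _ 2) ?nnegrE ?exprn_ge0 // (le_trans sq_le) //.
have -> : r ^+ (a + b) ^+ 2 = r ^+ (a + a) * r ^+ (b + b).
  by rewrite !exprD expr2 mulrACA.
by apply: ler_pM; [exact: walks_diag_ge0 | exact: walks_diag_ge0 | exact: diag..].
Qed.

(* Both factors are compared with powers of the single number [r] such that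
   [r ^+ (k + k)] is the larger of the two diagonal entries. *)
Lemma walks_mul_le k a b x y x1 y1 x2 y2 :
  (0 < k)%N -> (a + b = k + k)%N ->
  {subset [:: x1; y1; x2; y2] <= [:: x; y]} ->
  (forall n z w, 0 <= walks n z w) ->
  walks a x1 y1 * walks b x2 y2 <= walks (k + k) x x + walks (k + k) y y.
Proof.
move=> k_gt0 abk sub w_ge0; set P := fun z => walks (k + k) z z.
rewrite -!/(P _).
have P_ge0 z : 0 <= P z by exact: w_ge0.
(* Here [r ^+ (k + k)] is the sum of the two diagonal entries, which dominates each of them. *)
have [r r_ge0 rE] : exists2 r : R, 0 <= r & r ^+ (k + k) = P x + P y.
  by apply: exists_nth_root; rewrite ?addn_gt0 ?k_gt0 ?addr_ge0.
have le_r z : z \in [:: x1; y1; x2; y2] -> P z <= r ^+ (k + k).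
  move=> /sub; rewrite !inE rE => /orP[]/eqP->; first by rewrite lerDl.
  by rewrite lerDr.
rewrite -rE -abk exprD ler_pM //; apply: (@walks_le_pow k) => //;
  by [apply: le_r; rewrite !inE eqxx ?orbT | rewrite -abk ?leq_addr ?leq_addl].
Qed.

End Kernel.

(** * Walks with step-dependent weights *)

Section WalkSums.
Variables (R : realType) (T : finType).
Implicit Types (B : nat -> T -> T -> R) (v : T -> R) (x y z w : T) (s : seq T).

Fixpoint seq_sum n (F : seq T -> R) : R :=
  if n is n'.+1 then \sum_z seq_sum n' (fun s => F (z :: s)) else F [::].

Lemma seq_sumZ n c (F : seq T -> R) :
  seq_sum n (fun s => c * F s) = c * seq_sum n F.
Proof.
elim: n F => //= n IHn F; rewrite mulr_sumr.
by apply: eq_bigr => z _; rewrite IHn.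
Qed.

Lemma seq_sum_sum n (I : Type) (r : seq I) (P : pred I) (F : I -> seq T -> R) :
  seq_sum n (fun s => \sum_(i <- r | P i) F i s) = \sum_(i <- r | P i) seq_sum n (F i).
Proof.
elim: n F => //= n IHn F; rewrite exchange_big.
by apply: eq_bigr => z _; rewrite IHn.
Qed.

Lemma ler_seq_sum n (F G : seq T -> R) :
  (forall s, size s = n -> F s <= G s) -> seq_sum n F <= seq_sum n G.
Proof.
elim: n F G => [|n IHn] F G le_FG /=; first exact: le_FG.
by apply: ler_sum => z _; apply: IHn => s size_s; rewrite le_FG //= size_s.
Qed.

(** The kernel may vary with the step, so that chosen steps can be forced along a prescribed
    edge. *)
Fixpoint walk_wt B x s : R :=
  if s is z :: s' then B 0 x z * walk_wt (fun l => B l.+1) z s' else 1.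

Lemma walk_wtE x0 B x s :
  walk_wt B x s = \prod_(l < size s) B l (nth x0 (x :: s) l) (nth x0 (x :: s) l.+1).
Proof.
elim: s B x => [|z s IHs] B x /=; first by rewrite big_ord0.
by rewrite big_ord_recl /= IHs.
Qed.

(** The matrix product [B 0 B 1 ... B (n-1)] applied to [v]. *)
Fixpoint transfer B n v : T -> R :=
  if n is n'.+1 then act (B 0) (transfer (fun l => B l.+1) n' v) else v.

Lemma seq_sum_walk_wt B n v x :
  seq_sum n (fun s => walk_wt B x s * v (last x s)) = transfer B n v x.
Proof.
elim: n B x => [|n IHn] B x /=; first by rewrite mul1r.
apply: eq_bigr => z _; rewrite -IHn -seq_sumZ.
by congr seq_sum; apply/funext => s; rewrite mulrA.
Qed.

Lemma transferD B m n v :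
  transfer B (m + n) v = transfer B m (transfer (fun l => B (m + l)%N) n v).
Proof. by elim: m B => //= m IHm B; rewrite IHm. Qed.

Lemma eq_transfer B (M : T -> T -> R) n v :
  (forall l, (l < n)%N -> B l = M) -> transfer B n v = iter n (act M) v.
Proof.
elim: n B => //= n IHn B eqB; rewrite eqB // IHn // => l lt_ln.
exact: eqB.
Qed.

Definition single (M : T -> T -> R) x y : T -> T -> R :=
  fun a b => (a == x)%:R * (b == y)%:R * M x y.

(** A one-entry kernel has rank one, which is what cuts a walk at a pinned step. *)
Lemma act_single M x y v :
  act (single M x y) v = fun a => (M x y * v y) * delta R x a.
Proof.
apply/funext => a; rewrite /act (bigD1 y) //= big1 ?addr0 => [|b /negPf neq_b].
  by rewrite /single /delta eqxx mulr1; ring.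
by rewrite /single neq_b mulr0 !mul0r.
Qed.

Definition pinned (M : T -> T -> R) i j x y z w : nat -> T -> T -> R :=
  fun l => if l == i then single M x y else if l == j then single M z w else M.

(** The pinned steps cut a closed walk into an arc of length [b] from [y] to [z] and an arc from [w]
    back to [x]. The latter passes through the base point [x0]; summing over [x0] glues its pieces
    of lengths [c] and [a]. *)
Lemma trace_pinned (M : T -> T -> R) a b c x y z w :
  (forall x y, M x y = M y x) ->
  \sum_x0 transfer (pinned M a (a + b.+1) x y z w) (a + b.+1 + c.+1) (delta R x0) x0
  = M x y * M z w * (walks M b y z * walks M (c + a) w x).
Proof.
move=> M_sym.
transitivity (\sum_x0 M x y * M z w * walks M b y z *
    (walks M c w x0 * walks M a x0 x)); last first.
  by rewrite -mulr_sumr walksD // !mulrA.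
apply: eq_bigr => x0 _.
rewrite -addnA transferD (@eq_transfer _ M) => [|l lt_la]; last first.
  by rewrite /pinned !ifN //; lia.
rewrite addSn /= transferD /= (@eq_transfer _ M) => [|l lt_la]; last first.
  by rewrite /pinned !ifN //; lia.
rewrite (@eq_transfer _ M) => [|l lt_la]; last first.
  by rewrite /pinned !ifN //; lia.
rewrite /pinned addn0 eqxx ifN; last by lia.
rewrite ifT; last by lia.
rewrite !act_single !iter_act_scale /walks; ring.
Qed.

Lemma trace_pinned_lt (M : T -> T -> R) i j n x y z w :
  (forall x y, M x y = M y x) -> (i < j)%N -> (j < n)%N ->
  \sum_x0 transfer (pinned M i j x y z w) n (delta R x0) x0
  = M x y * M z w * (walks M (j - i.+1) y z * walks M (n - j.+1 + i) w x).
Proof.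
move=> M_sym lt_ij lt_jn.
have [b jE] : exists b, j = (i + b.+1)%N by exists (j - i.+1)%N; lia.
have [c nE] : exists c, n = (j + c.+1)%N by exists (n - j.+1)%N; lia.
have [-> ->] : (j - i.+1 = b)%N /\ (n - j.+1 = c)%N by lia.
by rewrite nE jE trace_pinned.
Qed.
End WalkSums.

(** * Repeated edges in closed walks *)

Lemma trace_sum (R : realType) (T I : finType) n (F : I -> T -> seq T -> R) :
  \sum_x seq_sum n (fun s => \sum_i F i x s) = \sum_i \sum_x seq_sum n (F i x).
Proof. by under eq_bigr do rewrite seq_sum_sum; rewrite exchange_big. Qed.

Lemma set2_eq (T : finType) (a b c d : T) :
  [set a; b] = [set c; d] -> (c, d) = (a, b) \/ (c, d) = (b, a).
Proof.
move=> eq_set.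
have /set2P c_ab : c \in [set a; b] by rewrite eq_set !inE eqxx.
have /set2P d_ab : d \in [set a; b] by rewrite eq_set !inE eqxx orbT.
have /set2P a_cd : a \in [set c; d] by rewrite -eq_set !inE eqxx.
have /set2P b_cd : b \in [set c; d] by rewrite -eq_set !inE eqxx orbT.
by case: c_ab => ?; case: d_ab => ?; case: a_cd => ?; case: b_cd => ?; subst; auto.
Qed.

Section Coincidences.
Variables (R : realType) (T : finType) (g : rel T) (n : nat).
Variable M : T -> T -> R.
Hypothesis M_ge0 : forall x y, 0 <= M x y.
Hypothesis M_sym : forall x y, M x y = M y x.
Hypothesis M_supp : forall x y, M x y != 0 -> g x y.
Hypothesis no_circuit : ~ has_circuit g n.

Lemma walk_wt_ge0 (B : nat -> T -> T -> R) x s :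
  (forall l x y, 0 <= B l x y) -> 0 <= walk_wt B x s.
Proof. by move=> B_ge0; rewrite (walk_wtE x) prodr_ge0. Qed.

Lemma walks_ge0 m x y : 0 <= walks M m x y.
Proof.
rewrite /walks; elim: m x => [|m IHm] x /=; first exact: ler0n.
by apply: sumr_ge0 => z _; rewrite mulr_ge0.
Qed.

Lemma pinned_ge0 i j x y z w l a b : 0 <= pinned M i j x y z w l a b.
Proof.
have single_ge0 x1 y1 : 0 <= single M x1 y1 a b by rewrite !mulr_ge0.
by rewrite /pinned; case: ifP => // _; case: ifP.
Qed.

(** Nonzero weight makes every step an edge, so the closed walk would be a circuit if its edges were
    distinct. Hence two steps share an edge, in equal or opposite directions. *)
Lemma walk_coincidence x s : size s = n -> last x s = x ->
  walk_wt (fun=> M) x s != 0 ->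
  exists i j (e : bool), [/\ (i < j)%N, (j < n)%N &
    let c := nth x (x :: s) in
    (c j, c j.+1) = if e then (c i, c i.+1) else (c i.+1, c i)].
Proof.
move=> size_s last_s; rewrite (walk_wtE x) prodf_seq_neq0 => /allP wt_neq0.
have adj l : (l < n)%N -> g (nth x (x :: s) l) (nth x (x :: s) l.+1).
  rewrite -size_s => lt_ln; apply: M_supp.
  exact: (wt_neq0 (Ordinal lt_ln) (mem_index_enum _)).
pose c (i : 'I_n) := nth x (x :: s) i.
(* At the last index [ordS] wraps around to 0, and [last x s = x] closes the walk. *)
have cS i : c (ordS i) = nth x (x :: s) i.+1.
  rewrite /c /=; have := ltn_ord i; rewrite leq_eqVlt => /predU1P[iS|lt_i].
    by rewrite iS modnn -{1}last_s -[RHS]/(nth x (x :: s) i.+1) iS -size_s -last_nth.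
  by rewrite modn_small.
pose f (i : 'I_n) := [set c i; c (ordS i)].
have pairs (i j : 'I_n) : (i < j)%N -> f i = f j ->
    exists i j (e : bool), [/\ (i < j)%N, (j < n)%N &
    let c := nth x (x :: s) in
    (c j, c j.+1) = if e then (c i, c i.+1) else (c i.+1, c i)].
  rewrite /f !cS => lt_ij /set2_eq[] eq_c.
    by exists i, j, true.
  by exists i, j, false.
have [/injectiveP f_inj|/injectivePn[i [j neq_ij eq_f]]] := boolP (injectiveb f).
  by case: no_circuit; exists c; split => // i; rewrite cS; exact/adj/ltn_ord.
have [lt_ij|lt_ji|/val_inj eq_ij] := ltngtP i j; first exact: (pairs i j).
  exact: (pairs j i).
by rewrite eq_ij eqxx in neq_ij.
Qed.

(** Pinning steps to the very edges they traverse changes none of the factors. *)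
Lemma walk_wt_pinned x s i j (e : bool) (c := nth x (x :: s)) : size s = n ->
  (c j, c j.+1) = (if e then (c i, c i.+1) else (c i.+1, c i)) ->
  walk_wt (fun=> M) x s =
  walk_wt (pinned M i j (c i) (c i.+1)
    (if e then c i else c i.+1) (if e then c i.+1 else c i)) x s.
Proof.
move=> size_s eq_c; rewrite !(walk_wtE x); apply: eq_bigr => l _.
rewrite /pinned -/c; case: eqP => [->|_]; first by rewrite /single !eqxx !mul1r.
case: eqP => // ->; move: eq_c; rewrite /single.
by case: (e) => -[-> ->]; rewrite !eqxx !mul1r.
Qed.

(* Each pair [i < j] of steps using the same edge is pinned to that edge [{x, y}];
   [e] tells whether both steps go in the same direction. *)
Lemma trace_le_coincidences :
  \sum_x walks M n x x <= \sum_(j < n) \sum_(i < j) \sum_x \sum_y \sum_(e : bool)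
    M x y ^+ 2 * (walks M (j - i.+1) y (if e then x else y)
                  * walks M (n - j.+1 + i) (if e then y else x) x).
Proof.
pose tr (i j : nat) x y (e : bool) x0 s :=
  walk_wt (pinned M i j x y (if e then x else y) (if e then y else x)) x0 s
  * delta R x0 (last x0 s).
have tr_ge0 i j x y e x0 s : 0 <= tr i j x y e x0 s.
  by rewrite mulr_ge0 ?ler0n // walk_wt_ge0 // => l a b; exact: pinned_ge0.
have -> : \sum_x walks M n x x =
    \sum_x seq_sum n (fun s => walk_wt (fun=> M) x s * delta R x (last x s)).
  by apply: eq_bigr => x _; rewrite seq_sum_walk_wt (@eq_transfer _ _ _ M).
(* Union bound: a closed walk of nonzero weight equals the term of one of its coincidences, and all
   other terms are nonnegative. *)
apply: (@le_trans _ _ (\sum_x0 seq_sum n (fun s =>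
    \sum_(j < n) \sum_(i < j) \sum_x \sum_y \sum_e tr i j x y e x0 s))); last first.
  rewrite trace_sum; apply: ler_sum => j _; rewrite trace_sum; apply: ler_sum => i _.
  rewrite trace_sum; apply: ler_sum => x _; rewrite trace_sum; apply: ler_sum => y _.
  rewrite trace_sum; apply: ler_sum => e _.
  under eq_bigr do rewrite seq_sum_walk_wt.
  rewrite trace_pinned_lt ?ltn_ord // expr2.
  by case: e => //; rewrite [M y x]M_sym.
apply: ler_sum => x _; apply: ler_seq_sum => s size_s.
have [last_s|/negPf last_s] := eqVneq (last x s) x; last first.
  rewrite {1}/delta last_s mulr0.
  by do 5!apply: sumr_ge0 => ? _; exact: tr_ge0.
have [->|wt_neq0] := eqVneq (walk_wt (fun=> M) x s) 0.
  by rewrite mul0r; do 5!apply: sumr_ge0 => ? _; exact: tr_ge0.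
have [i [j [e [lt_ij lt_jn eq_c]]]] := walk_coincidence size_s last_s wt_neq0.
set c := nth x (x :: s) in eq_c.
rewrite (walk_wt_pinned size_s eq_c).
apply: le_trans (ler_sum_term (Ordinal lt_jn) _); last first.
  by move=> ?; do 4!apply: sumr_ge0 => ? _; exact: tr_ge0.
apply: le_trans (ler_sum_term (Ordinal lt_ij) _); last first.
  by move=> ?; do 3!apply: sumr_ge0 => ? _; exact: tr_ge0.
apply: le_trans (ler_sum_term (c i) _); last first.
  by move=> ?; do 2!apply: sumr_ge0 => ? _; exact: tr_ge0.
apply: le_trans (ler_sum_term (c i.+1) _); last first.
  by move=> ?; apply: sumr_ge0 => ? _; exact: tr_ge0.
by apply: le_trans (ler_sum_term e _) => // ?; exact: tr_ge0.
Qed.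

Hypothesis M_row : forall x, \sum_y M x y ^+ 2 <= 1.

(** The two arcs have total length [n - 2 = k + k], so their product is at most the sum of the
    diagonal entries at the two ends of the edge; [M_row] then sums out the squared weights. *)
Lemma trace_recursion k : (0 < k)%N -> n = (k + k).+2 ->
  \sum_x walks M n x x <= ('C(n, 2) * 4)%:R * \sum_x walks M (k + k) x x.
Proof.
move=> k_gt0 nE; apply: (le_trans trace_le_coincidences).
set P := fun x => walks M (k + k) x x; rewrite -/(\sum_x P x).
have P_ge0 x : 0 <= P x by exact: walks_ge0.
have row_le : \sum_x \sum_y M x y ^+ 2 * P x <= \sum_x P x.
  by apply: ler_sum => x _; rewrite -mulr_suml ler_piMl.
have pair_le (i j : nat) : (i < j)%N -> (j < n)%N ->
    \sum_x \sum_y \sum_(e : bool) M x y ^+ 2 *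
      (walks M (j - i.+1) y (if e then x else y)
       * walks M (n - j.+1 + i) (if e then y else x) x) <= 4%:R * \sum_x P x.
  move=> lt_ij lt_jn.
  (* Each coefficient 2 counts the values of [e]; symmetry of [M] puts [P y] against the row of
     [y]. *)
  apply: (@le_trans _ _ (\sum_x \sum_y
      (2%:R * (M x y ^+ 2 * P x) + 2%:R * (M y x ^+ 2 * P y)))).
    apply: ler_sum => x _; apply: ler_sum => y _.
    have -> : 2%:R * (M x y ^+ 2 * P x) + 2%:R * (M y x ^+ 2 * P y) =
        \sum_(e : bool) M x y ^+ 2 * (P x + P y).
      by rewrite sumr_const card_bool [M y x]M_sym -mulr_natl; ring.
    apply: ler_sum => e _; rewrite ler_wpM2l ?sqr_ge0 //.
    apply: walks_mul_le => //; [by lia | | exact: walks_ge0].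
    by case: e => z; rewrite !inE; do ?case: eqP => //= _; rewrite ?orbT.
  under eq_bigr do rewrite big_split /=.
  rewrite big_split /= [X in _ + X]exchange_big /=.
  under eq_bigr do rewrite -mulr_sumr.
  rewrite -mulr_sumr.
  have := row_le; lra.
apply: (@le_trans _ _ (\sum_(j < n) \sum_(i < j) 4%:R * \sum_x P x)).
  apply: ler_sum => j _; apply: ler_sum => i _.
  exact: pair_le (ltn_ord i) (ltn_ord j).
(* There are ['C(n, 2)] pairs [i < j]. *)
set Y := 4%:R * _; under eq_bigr do rewrite sumr_const card_ord -[Y *+ _]mulr_natl.
rewrite -mulr_suml -natr_sum natrM /Y -mulrA -bin2_sum big_mkord.
exact: lexx.
Qed.
End Coincidences.

(** * Upper and lower bounds on traces *)

Section TraceBounds.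
Variables (R : realType) (T : finType) (M : T -> T -> R).
Hypothesis M_sym : forall x y, M x y = M y x.

(** With threshold [2 * C] in the log-convex bound, the tail contributes only half of the left side
    and is absorbed there. *)
Lemma trace_on_le (X : {set T}) C k : 0 < C ->
  \sum_(x in X) walks M (k.+1 + k.+1) x x <= C * \sum_(x in X) walks M (k + k) x x ->
  \sum_(x in X) walks M (k.+1 + k.+1) x x <= #|X|%:R * (2 * C) ^+ k.+1.
Proof.
move=> C_gt0; set S := \sum_(x in X) walks M (k.+1 + k.+1) x x => S_le.
have l_gt0 : 0 < 2 * C by rewrite mulr_gt0.
have thr : \sum_(x in X) walks M (k + k) x x <= #|X|%:R * (2 * C) ^+ k + S / (2 * C).
  rewrite /S mulr_suml mulr_natl -sumr_const -big_split /=.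
  apply: ler_sum => x _; rewrite -[(2 * C) ^+ k]mulr1 -[X in _ * X](walks0 M x).
  apply: (@logconvex_le_threshold _ (fun i => walks M (i + i) x x)) => // i.
    exact: walks_diag_ge0.
  exact: walks_logconvex.
have := le_trans S_le (ler_wpM2l (ltW C_gt0) thr).
have -> : C * (#|X|%:R * (2 * C) ^+ k + S / (2 * C)) =
    C * #|X|%:R * (2 * C) ^+ k + S / 2 by field; rewrite gt_eqF.
have -> : #|X|%:R * (2 * C) ^+ k.+1 = 2 * (C * #|X|%:R * (2 * C) ^+ k).
  by rewrite exprS; ring.
by lra.
Qed.

(** The sequence [<1, M^(2j) 1>] is log-convex, so it grows at least geometrically with its first
    ratio [|M 1|^2 / |T|]. *)
Lemma trace_ge k : (0 < #|T|)%N ->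
  (\sum_x (\sum_y M x y) ^+ 2) ^+ k <= #|T|%:R ^+ k * \sum_x walks M (k + k) x x.
Proof.
move=> T_gt0; pose one : T -> R := fun=> 1.
pose s j := dot one (iter (j + j) (act M) one).
have s0 : s 0 = #|T|%:R.
  by rewrite /s /dot /= (eq_bigr (fun=> 1)) ?sumr_const // => x _; rewrite mulr1.
have s1 : s 1 = \sum_x (\sum_y M x y) ^+ 2.
  rewrite /s -(dot_iter M_sym) /dot /=; apply: eq_bigr => x _.
  by rewrite -expr2; congr (_ ^+ 2); apply: eq_bigr => y _; rewrite mulr1.
have s_ge0 j : 0 <= s j by rewrite /s -(dot_iter M_sym) dot_ge0.
(* Entry [x] of [M^k 1] pairs [M^k delta_x] with [1]; by Cauchy-Schwarz its square is at most [|T|]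
   times a diagonal entry. *)
have sk : s k <= #|T|%:R * \sum_x walks M (k + k) x x.
  rewrite /s -(dot_iter M_sym) mulr_sumr; apply: ler_sum => x _.
  have -> : iter k (act M) one x = dot (iter k (act M) (delta R x)) one.
    by rewrite -[one in RHS]/(iter 0 (act M) one) dot_iter // addn0 dot_delta.
  rewrite -expr2 -s0 -walks_dot // mulrC.
  exact: dot_cauchy_schwarz.
have := logconvex_expr s_ge0 (dot_iter_logconvex M_sym one) k.
have T_gt0R : 0 < #|T|%:R :> R by rewrite ltr0n.
rewrite s1 s0 => energy; rewrite -(ler_pM2r T_gt0R) (le_trans energy) //.
by rewrite -mulrA ler_wpM2l ?exprn_ge0 // [leRHS]mulrC.
Qed.

(** The first step of a closed walk crosses to the other class, so moving the base point along it
    exchanges the classes; hence the positive length [m.+1]. *)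
Lemma trace_bipartite (A : {set T}) m :
  (forall x y, M x y != 0 -> (x \in A) != (y \in A)) ->
  \sum_(x in A) walks M m.+1 x x = \sum_(x in ~: A) walks M m.+1 x x.
Proof.
move=> bip; have [inA notinA] : (forall x y, x \in A -> y \in A -> M x y = 0) /\
    (forall x y, x \notin A -> y \notin A -> M x y = 0).
  split=> x y xA yA; have [//|/bip] := eqVneq (M x y) 0; first by rewrite xA yA.
  by rewrite (negPf xA) (negPf yA).
transitivity (\sum_(x in A) \sum_(y in ~: A) M x y * walks M m y x).
  apply: eq_bigr => x xA; rewrite [LHS](bigID (mem (~: A))) /=.
  rewrite [X in _ + X]big1 ?addr0 // => y; rewrite inE negbK => yA.
  by rewrite inA ?mul0r.
rewrite exchange_big; apply: eq_bigr => y; rewrite inE => yA.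
rewrite [RHS](bigID (mem A)) /= [X in _ + X]big1 ?addr0 => [|x xA].
  by apply: eq_bigr => x _; rewrite M_sym walksC.
by rewrite notinA ?mul0r.
Qed.

End TraceBounds.

(** * Edge weights adapted to the degrees *)

Section DegreeWeights.
Variables (R : realType) (T : finType) (g : rel T).
Hypothesis g_sym : symmetric g.

Definition degree x : nat := (\sum_y g x y)%N.
(** Counts the edges at [x] whose weight is exactly [1 / sqrt (degree x)]. *)
Definition down_degree x : nat := (\sum_y (g x y && (degree y <= degree x)))%N.
Definition weight x y : R := (g x y)%:R / Num.sqrt (maxn (degree x) (degree y))%:R.

Lemma weight_ge0 x y : 0 <= weight x y.
Proof. by rewrite divr_ge0 ?sqrtr_ge0. Qed.

Lemma weightC x y : weight x y = weight y x.
Proof. by rewrite /weight g_sym maxnC. Qed.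

Lemma weight_supp x y : weight x y != 0 -> g x y.
Proof. by rewrite /weight; case: (g x y) => //; rewrite mul0r eqxx. Qed.

Lemma degree_gt0 x y : g x y -> (0 < degree x)%N.
Proof. by move=> gxy; rewrite /degree (bigD1 y) //= gxy. Qed.

(** Each of the [degree x] nonzero squares is at most [1 / degree x]. *)
Lemma weight_row x : \sum_y weight x y ^+ 2 <= 1.
Proof.
have [d0|d_gt0] := posnP (degree x).
  rewrite big1 ?ler01 // => y _; rewrite /weight.
  by have [/degree_gt0|_] := boolP (g x y); rewrite ?d0 // mul0r expr0n.
have dR : 0 < (degree x)%:R :> R by rewrite ltr0n.
apply: (@le_trans _ _ (\sum_y (g x y)%:R / (degree x)%:R)); last first.
  by rewrite -mulr_suml -natr_sum divff // gt_eqF.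
apply: ler_sum => y _; rewrite /weight expr_div_n sqr_sqrtr // -natrX.
have -> : (g x y ^ 2 = g x y)%N by case: (g x y).
rewrite ler_wpM2l // lef_pV2 ?posrE ?ler_nat ?leq_maxl //.
by rewrite ltr0n leq_max d_gt0.
Qed.

(** [degree] counts each edge from both ends, [down_degree] from at least one. *)
Lemma sum_degree_le : (\sum_x degree x <= 2 * \sum_x down_degree x)%N.
Proof.
have sumE : (\sum_x down_degree x = \sum_x \sum_y (g x y && (degree x <= degree y)))%N.
  rewrite [RHS]exchange_big; apply: eq_bigr => x _; apply: eq_bigr => y _.
  by rewrite [in RHS]g_sym.
rewrite mul2n -addnn [X in (_ <= X + _)%N]sumE -big_split leq_sum //= => x _.
rewrite -big_split leq_sum //= => y _.
case: (g x y) => //=; have := leq_total (degree x) (degree y).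
by case: (degree x <= _)%N; case: (degree y <= _)%N.
Qed.

(** Every edge is obtained by directing it from an end of larger degree; ties give it twice. *)
Lemma nedges_le : (nedges g <= \sum_x down_degree x)%N.
Proof.
pose D := [set q : T * T | g q.1 q.2 && (degree q.2 <= degree q.1)%N].
have -> : (\sum_x down_degree x = #|D|)%N.
  rewrite pair_big /= -sum1_card big_mkcond [RHS]big_mkcond.
  by apply: eq_bigr => q _; rewrite inE; case: (_ && _).
apply: leq_trans (leq_imset_card (fun q => [set q.1; q.2]) D).
apply/subset_leq_card/fintype.subsetP => E; rewrite inE.
move=> /existsP[x /existsP[y /andP[gxy /eqP ->]]].
apply/imsetP; have [le_yx|/ltnW le_xy] := leqP (degree y) (degree x).
  by exists (x, y); rewrite // inE /= gxy.
by exists (y, x); rewrite /= 1?finset.setUC // inE /= g_sym gxy.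
Qed.

(** With [d] the degree and [d'] the down-degree, row [x] sums to at least [d' / sqrt d], and
    [d'^2 / d >= d' - d / 4] amounts to [(d' - d / 2)^2 >= 0]. A quarter of the degree sum is at
    most half the sum of [d']. *)
Lemma weight_energy :
  (nedges g)%:R / 2 <= \sum_x (\sum_y weight x y) ^+ 2.
Proof.
apply: (@le_trans _ _ (\sum_x ((down_degree x)%:R - (degree x)%:R / 4 : R))).
  rewrite sumrB -mulr_suml -!natr_sum.
  have : (\sum_x degree x)%N%:R <= 2 * (\sum_x down_degree x)%N%:R :> R.
    by rewrite -natrM ler_nat sum_degree_le.
  have : (nedges g)%:R <= (\sum_x down_degree x)%N%:R :> R.
    by rewrite ler_nat nedges_le.
  by lra.
apply: ler_sum => x _.
set d : R := (degree x)%:R; set d' : R := (down_degree x)%:R.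
have le_d' : d' <= d.
  by rewrite ler_nat leq_sum // => y _; case: (g x y) => //=; case: (degree y <= _)%N.
have [d0|d_gt0] := posnP (degree x).
  have := sqr_ge0 (\sum_y weight x y); move: le_d'.
  by rewrite /d d0; lra.
have dR : 0 < d by rewrite ltr0n.
have le_row : d' / Num.sqrt d <= \sum_y weight x y.
  rewrite /d' natr_sum mulr_suml; apply: ler_sum => y _.
  have [/andP[gxy le_yx]|_] := boolP (_ && _); last by rewrite mul0r weight_ge0.
  by rewrite /weight gxy (maxn_idPl le_yx).
apply: (@le_trans _ _ ((d' / Num.sqrt d) ^+ 2)); last first.
  by rewrite lerXn2r ?nnegrE ?sumr_ge0 ?divr_ge0 ?sqrtr_ge0 // => y _; exact: weight_ge0.
rewrite expr_div_n sqr_sqrtr ?(ltW dR) // ler_pdivlMr //.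
have := sqr_ge0 (d' - d / 2); nra.
Qed.

End DegreeWeights.

(** * From trace bounds to edge counts *)

Lemma ler_nth_root (R : realType) (K : nat) (a b m : R) : (0 < K)%N ->
  0 <= a -> 0 <= b -> 0 <= m -> a ^+ K <= m * b ^+ K -> a <= m `^ K%:R^-1 * b.
Proof.
move=> K_gt0 a_ge0 b_ge0 m_ge0 le_pow.
rewrite -(ler_pXn2r K_gt0) ?nnegrE ?mulr_ge0 ?powR_ge0 // exprMn.
rewrite -[(m `^ _) ^+ K]powR_mulrn ?powR_ge0 // -powRrM mulVf ?powRr1 //.
by rewrite pnatr_eq0 -lt0n.
Qed.

(** [X] and [c] serve both bounds: all vertices with [c = 1], or the smaller class of a bipartite
    graph with [c = 2]. *)
Lemma nedges_pow_le (R : realType) (T : finType) (g : rel T) (k c : nat)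
    (X : {set T}) :
  symmetric g -> (0 < #|T|)%N -> (0 < k)%N -> ~ has_circuit g (k.+1 + k.+1) ->
  (0 < c)%N ->
  (forall m, \sum_x walks (weight R g) m.+1 x x
             = c%:R * \sum_(x in X) walks (weight R g) m.+1 x x) ->
  ((nedges g)%:R / 2) ^+ k.+1
  <= #|T|%:R ^+ k.+1 * (c%:R * (#|X|%:R * (16 * k.+1%:R ^+ 2) ^+ k.+1)) :> R.
Proof.
move=> g_sym T_gt0 k_gt0 no_circ c_gt0 traceE.
have w_sym := @weightC R T g g_sym.
apply: (@le_trans _ _ ((\sum_x (\sum_y weight R g x y) ^+ 2) ^+ k.+1)).
  by rewrite lerXn2r ?nnegrE ?divr_ge0 ?sumr_ge0 ?weight_energy // => x _; exact: sqr_ge0.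
apply: (le_trans (trace_ge w_sym _ T_gt0)); rewrite ler_wpM2l ?exprn_ge0 //.
have cR : 0 < c%:R :> R by rewrite ltr0n.
rewrite addSn traceE ler_wpM2l ?(ltW cR) // -addSn.
have nE : (k.+1 + k.+1 = (k + k).+2)%N by rewrite addSn addnS.
have kE : (k + k = (k + k).-1.+1)%N by rewrite prednK // addn_gt0 k_gt0.
have := trace_recursion (@weight_ge0 R T g) w_sym (@weight_supp R T g) no_circ
  (@weight_row R T g) k_gt0 nE.
(* With both traces written over [X], the factor [c] cancels from the recursion. *)
set C : R := (_ * 4)%:R; rewrite kE {1}addSn !traceE -kE -addSn mulrCA.
rewrite (ler_pM2l cR) => /trace_on_le.
have C_gt0 : 0 < C by rewrite ltr0n muln_gt0 bin_gt0; lia.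
move=> /(_ w_sym C_gt0)/le_trans; apply; rewrite ler_wpM2l //.
rewrite lerXn2r ?nnegrE ?mulr_ge0 ?exprn_ge0 ?(ltW C_gt0) //.
(* For [K = k.+1], [2 * C] equals [8 K (2 K - 1)], which is at most [16 K^2]. *)
rewrite /C -natrX -!natrM ler_nat bin2.
have := leq_trunc_div ((k.+1 + k.+1) * (k.+1 + k.+1).-1) 2.
rewrite -divn2; nia.
Qed.

Theorem theorem5p1 (R : realType) (p : nat) (T : finType) (g : rel T) :
  (4 <= p)%N -> ~~ odd p ->
  symmetric g -> irreflexive g -> (0 < #|T|)%N ->
  ~ has_circuit g p ->
  ((nedges g)%:R <= 18 * pi ^+ 2 * (p%:R) ^+ 2 * (#|T|%:R `^ (1 + 2 / p%:R)) :> R)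
  /\
  (forall A : {set T}, (forall x y, g x y -> (x \in A) != (y \in A)) ->
     (nedges g)%:R <= 9 * pi ^+ 2 * (p%:R) ^+ 2
        * ((minn #|A| #|~: A|)%:R `^ (2 / p%:R)) * (maxn #|A| #|~: A|)%:R :> R).
Proof.
move=> p_ge4 p_even g_sym _ T_gt0.
have [k k_gt0 ->] : exists2 k, (0 < k)%N & p = (k.+1 + k.+1)%N.
  by exists (p./2).-1; lia.
move=> no_circ; have := fun c X => @nedges_pow_le R T g k c X g_sym T_gt0 k_gt0 no_circ.
(* The argument yields the constants 8 and 32 in front of [p^2]; this inequality places them below
   [18 * pi ^+ 2] and [9 * pi ^+ 2]. *)
have pi_sq : 4 <= pi ^+ 2 :> R by have := pi_ge2 R; nra.
have -> : 2 / (k.+1 + k.+1)%:R = k.+1%:R^-1 :> R.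
  by rewrite addnn -mul2n natrM invfM mulrA divff ?mul1r // pnatr_eq0.
rewrite natrD; set q : R := k.+1%:R; have q_gt0 : 0 < q by rewrite ltr0n.
set t : R := #|T|%:R; set e : R := (nedges g)%:R => bound.
have e_ge0 : 0 <= e by [].
have t_gt0 : 0 < t by rewrite ltr0n.
have q2_gt0 : 0 < q ^+ 2 by rewrite exprn_gt0.
split.
  have trT m : \sum_x walks (weight R g) m.+1 x x =
      1%:R * \sum_(x in [set: T]) walks (weight R g) m.+1 x x.
    by rewrite mul1r; apply: eq_bigl => x; rewrite inE.
  have := bound 1%N [set: T] isT trT; rewrite cardsT mul1r -/t => le_pow.
  have : e / 2 <= t `^ q^-1 * (t * (16 * q ^+ 2)).
    apply: ler_nth_root; rewrite ?divr_ge0 ?mulr_ge0 ?(ltW t_gt0) ?(ltW q2_gt0) //.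
    by rewrite [(t * _) ^+ _]exprMn mulrCA.
  rewrite powRD ?powRr1 ?(ltW t_gt0) //; last by rewrite (gt_eqF t_gt0) implybT.
  have u_ge0 : 0 <= t `^ q^-1 * t * q ^+ 2 by rewrite !mulr_ge0 ?powR_ge0 ?ltW.
  move: (t `^ _) u_ge0 => u u_ge0 le_e.
  have := ler_wpM2r u_ge0 pi_sq; lra.
move=> A bip.
(* Both classes carry the same trace, so the full trace is twice that of the smaller class. *)
have [X cardX trX] : exists2 X : {set T}, #|X| = minn #|A| #|~: A| & forall m,
    \sum_x walks (weight R g) m.+1 x x = 2%:R * \sum_(x in X) walks (weight R g) m.+1 x x.
  have half m := trace_bipartite (weightC R g_sym) m
    (fun x y wxy => bip x y (weight_supp wxy)).
  have split m : \sum_x walks (weight R g) m.+1 x x =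
      \sum_(x in A) walks (weight R g) m.+1 x x +
      \sum_(x in ~: A) walks (weight R g) m.+1 x x.
    rewrite (bigID (mem A)) /=; congr (_ + _).
    by apply: eq_bigl => x; rewrite inE.
  have [le_A|/ltnW le_A] := leqP #|A| #|~: A|.
    by exists A => [|m]; rewrite // split -half -mulr2n mulr_natl.
  by exists (~: A) => [|m]; rewrite // split half -mulr2n mulr_natl.
have := bound 2%N X isT trX; rewrite cardX.
set m : R := (minn _ _)%:R; set M : R := (maxn _ _)%:R => le_pow.
have t_le : t <= 2 * M.
  rewrite /t /M -natrM ler_nat -(cardsC A); lia.
have : e / 2 <= m `^ q^-1 * (t * (32 * q ^+ 2)).
  apply: ler_nth_root; rewrite ?divr_ge0 ?mulr_ge0 ?(ltW t_gt0) ?(ltW q2_gt0) //.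
  apply: (le_trans le_pow).
  have -> : t * (32 * q ^+ 2) = 2 * (t * (16 * q ^+ 2)) by ring.
  (* The factor [c = 2] is absorbed into the [k.+1]-st power, which turns 16 into 32. *)
  have two_le : 2 <= 2 ^+ k.+1 :> R.
    by rewrite exprS ler_peMr // exprn_ege1 // ler1n.
  rewrite [(2 * _) ^+ _]exprMn [(t * _) ^+ _]exprMn.
  have a_ge0 : 0 <= t ^+ k.+1 * (m * (16 * q ^+ 2) ^+ k.+1).
    by rewrite !mulr_ge0 ?exprn_ge0 ?mulr_ge0 ?(ltW t_gt0) ?(ltW q2_gt0).
  by have := ler_wpM2r a_ge0 two_le; lra.
have u_ge0 : 0 <= m `^ q^-1 * q ^+ 2 by rewrite !mulr_ge0 ?powR_ge0 ?ltW.
move: (m `^ _) u_ge0 => u u_ge0 le_e.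
have M_ge0 : 0 <= M by [].
have := ler_wpM2r (mulr_ge0 u_ge0 M_ge0) pi_sq.
have := ler_wpM2l u_ge0 t_le; lra.
Qed.
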